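(* Let $t\ge 3$ and $1\le s\le t$ be integers and let $H$ be a connected non-bipartite graph. Then for every $n$ and every coloring of the edges of $K_n$ with $t$ colors, there is a family of pairwise vertex-disjoint monochromatic copies of $H$, whose colors together comprise at most $s$ distinct colors, covering at least $\frac{s(n-R_t(H))}{t}$ vertices. On the other hand, for every $n$ divisible by $t$, the edges of $K_n$ can be colored with $t$ colors so that every family of pairwise vertex-disjoint monochromatic copies of $H$ using at most $s$ colors in total covers at most $\frac{sn}{t}$ vertices.
   Context: $R_t(H)$ denotes the smallest integer $m$ such that in every coloring of the edges of $K_m$ with $t$ colors there is a monochromatic copy of $H$. A copy of $H$ is monochromatic if all of its edges receive the same color. *)

(* Defs.v *)
From HB Require Import structures.
From mathcomp Require Import all_boot all_order all_algebra.

Set Implicit Arguments.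
Unset Strict Implicit.
Unset Printing Implicit Defensive.

Record sgraph := SGraph {
  vert :> finType;
  adj : rel vert;
  adj_sym : symmetric adj;
  adj_irrefl : irreflexive adj }.

Definition connected (H : sgraph) : Prop :=
  0 < #|H| /\ forall u v : H, connect (@adj H) u v.

Definition bipartite (H : sgraph) : Prop :=
  exists side : H -> bool, forall u v : H, adj u v -> side u != side v.

(* The edge xy of the complete graph on 'I_n is the two-element set
   [set x; y]; the values of a coloring on sets of any other size are never
   used. *)
Definition edge_coloring (n t : nat) := {ffun {set 'I_n} -> 'I_t}.

(* A copy of H in the complete graph on 'I_n is given by an injection of the
   vertices of H. *)
Definition copy_of_color (H : sgraph) n t (c : edge_coloring n t) (i : 'I_t)
    (f : {ffun H -> 'I_n}) : bool :=
  injectiveb f &&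
  [forall u : H, forall v : H, adj u v ==> (c [set f u; f v] == i)].

Definition mono_copy (H : sgraph) n t (c : edge_coloring n t)
    (f : {ffun H -> 'I_n}) : bool :=
  [exists i : 'I_t, copy_of_color c i f].

Definition copy_verts (H : sgraph) n (f : {ffun H -> 'I_n}) : {set 'I_n} :=
  f @: [set: H].

Definition mono_disjoint_family (H : sgraph) n t (c : edge_coloring n t)
    (F : {set {ffun H -> 'I_n}}) : Prop :=
  (forall f, f \in F -> mono_copy c f) /\
  (forall f g, f \in F -> g \in F -> f != g ->
     [disjoint copy_verts f & copy_verts g]).

Definition family_colors (H : sgraph) n t (c : edge_coloring n t)
    (F : {set {ffun H -> 'I_n}}) : {set 'I_t} :=
  [set i | [exists f in F, copy_of_color c i f]].

Definition covered (H : sgraph) n (F : {set {ffun H -> 'I_n}}) : {set 'I_n} :=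
  \bigcup_(f in F) copy_verts f.

Definition forces_mono_copy (t : nat) (H : sgraph) (m : nat) : bool :=
  [forall c : edge_coloring m t, exists f : {ffun H -> 'I_m}, mono_copy c f].

Lemma ramsey_cliques (t : nat) (k : 'I_t -> nat) :
  exists m, forall (T : finType) (c : {set T} -> 'I_t) (A : {set T}),
    m <= #|A| ->
    exists (i : 'I_t) (B : {set T}),
      [/\ B \subset A, k i <= #|B|
        & {in B &, forall x y, x != y -> c [set x; y] = i}].
Proof.
have [N] := ubnP (\sum_i k i); elim: N k => // N IHN k; rewrite ltnS => leN.
have [/existsP[i /eqP ki0] | /existsPn k_gt0] := boolP [exists i, k i == 0].
  exists 0 => T c A _; exists i, set0; split; rewrite ?sub0set ?ki0 //.
  by move=> x y; rewrite inE.
pose k' i j := if j == i then (k j).-1 else k j.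
have IH i : exists m, forall (T : finType) (c : {set T} -> 'I_t) (A : {set T}),
    m <= #|A| -> exists (j : 'I_t) (B : {set T}),
      [/\ B \subset A, k' i j <= #|B|
        & {in B &, forall x y, x != y -> c [set x; y] = j}].
  apply: IHN; apply: leq_trans leN.
  rewrite (bigD1 i) //= [X in _ < X](bigD1 i) //= /k' eqxx -addSn prednK ?lt0n //.
  rewrite leq_add2l; apply: leq_sum => j /negPf nji; by rewrite nji.
have [m mP] := fin_all_exists IH.
exists (\sum_i m i).+1 => T c A leA.
have /set0Pn[x xA] : A != set0 by rewrite -card_gt0 (leq_trans _ leA).
pose S i := [set y in A :\ x | c [set x; y] == i].
have [i leS] : exists i, m i <= #|S i|.
  apply/existsP; apply: contraT => /existsPn ltS.
  have : #|A :\ x| = \sum_i #|S i|.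
    rewrite -sum1_card (partition_big (fun y => c [set x; y]) xpredT) //=.
    apply: eq_bigr => i _; rewrite -sum1_card; apply: eq_bigl => y.
    by rewrite !inE.
  move: leA; rewrite (cardsD1 x) xA add1n ltnS => leA eqA.
  pose i0 := c set0.
  move: leA; rewrite eqA leqNgt => /negP[].
  rewrite (bigD1 i0) //= [X in _ < X](bigD1 i0) //= -addSn leq_add //.
    by rewrite ltnNge ltS.
  by apply: leq_sum => j _; rewrite ltnW // ltnNge ltS.
have [j [B [sBS leB monoB]]] := mP i T c (S i) leS.
have sSA : S i \subset A by apply/subsetP => y; rewrite !inE -andbA => /and3P[].
have [eji | nji] := eqVneq j i; last first.
  exists j, B; split=> //; first exact: subset_trans sSA.
  by move: leB; rewrite /k' (negPf nji).
have xB : x \notin B.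
  by apply/negP => /(subsetP sBS); rewrite !inE eqxx.
have cx y : y \in B -> c [set x; y] = i.
  by move=> /(subsetP sBS); rewrite inE => /andP[_ /eqP].
exists i, (x |: B); split.
- by rewrite subUset sub1set xA (subset_trans sBS).
- move: leB; rewrite /k' eji eqxx cardsU1 xB add1n.
  by case: (k i) => // ?; rewrite ltnS.
- move=> y z; rewrite !inE => /orP[/eqP-> | yB] /orP[/eqP-> | zB].
  + by rewrite eqxx.
  + by move=> _; apply: cx.
  + by move=> _; rewrite setUC; apply: cx.
  + by move=> nyz; rewrite -eji; apply: monoB.
Qed.

Lemma ramsey_exists (t : nat) (H : sgraph) :
  exists m, forces_mono_copy t H m.
Proof.
have [m mP] := ramsey_cliques (fun _ : 'I_t => #|H|).
exists m; apply/forallP => c.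
have [|i [B [_ leB monoB]]] := mP _ c [set: 'I_m]; first by rewrite cardsT card_ord.
pose f := [ffun v : H => enum_val (widen_ord leB (enum_rank v))].
have f_inj : injective f.
  move=> u v; rewrite !ffunE => /enum_val_inj /(congr1 val) /= /ord_inj.
  exact: enum_rank_inj.
apply/existsP; exists f; apply/existsP; exists i; apply/andP; split.
  exact/injectiveP.
apply/forallP => u; apply/forallP => v; apply/implyP => uv.
apply/eqP; apply: monoB; try by rewrite ffunE; apply: enum_valP.
by apply: contraTneq uv => /f_inj->; rewrite adj_irrefl.
Qed.

Definition ramsey (t : nat) (H : sgraph) : nat := ex_minn (ramsey_exists t H).

(* Main.v *)
(** Lower bound: a maximal disjoint family of monochromatic copies misses fewer
    than [R_t(H)] vertices, and its [s] most frequent colors account for at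
    least [s / t] of its copies.

    Upper bound: split the vertices into [t] equal classes [V_0, ..., V_(t-1)],
    give color [i] to the edges inside [V_i], and give every edge between two
    classes a color [i] such that it avoids [V_i] and has exactly one end in
    [V_(i+1)] (indices mod [t]); this is possible as [t >= 3]. The edges of
    color [i] that leave [V_i] untouched form a bipartite graph, so a connected
    non-bipartite graph of color [i] lies inside [V_i]. *)
Require Import Defs.
From mathcomp Require Import all_boot all_order all_algebra.
From mathcomp Require Import zify.

Set Implicit Arguments.
Unset Strict Implicit.
Unset Printing Implicit Defensive.

Import Order.TTheory GRing.Theory Num.Theory.
Local Open Scope ring_scope.

(** * Averaging, and colorings chosen edge by edge *)

(** Deleting an element of least weight never lowers the average weight, so one can delete from the
    whole type down to [s] elements. The two averages are compared with denominators cleared. *)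
Lemma exists_heavy_subset (T : finType) (w : T -> nat) (s : nat) :
  (s <= #|T|)%N ->
  exists2 S : {set T}, #|S| = s &
    (s * \sum_i w i <= #|T| * \sum_(i in S) w i)%N.
Proof.
move=> le_sT; rewrite -(subKn le_sT).
elim: (#|T| - s)%N (leq_subr s #|T|) => [|d IHd] ltdT.
  exists setT; first by rewrite cardsT subn0.
  by rewrite subn0; under [in leqRHS]eq_bigl => i do rewrite inE.
have [S cardS leS] := IHd (ltnW ltdT).
have /card_gt0P[j0 j0S] : (0 < #|S|)%N by rewrite cardS subn_gt0.
(* Drop the lightest element of [S]. *)
case: (@arg_minnP _ _ (mem S) w j0S) => j /= jS minj.
have sumS : (\sum_(i in S) w i = w j + \sum_(i in S :\ j) w i)%N.
  by rewrite (big_setD1 j).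
have card_S : #|S| = #|S :\ j|.+1 by rewrite (cardsD1 j) jS.
have lightj : (#|S :\ j| * w j <= \sum_(i in S :\ j) w i)%N.
  by rewrite -sum_nat_const leq_sum // => i /setD1P[_ /minj].
have card_Sj : #|S :\ j| = (#|T| - d.+1)%N by rewrite subnS -cardS card_S.
exists (S :\ j) => //; rewrite -card_Sj -(leq_pmul2l (ltn0Sn #|S :\ j|)).
rewrite mulnCA [leqRHS]mulnCA.
apply: leq_trans (leq_mul (leqnn _) (_ : _ <= #|T| * (w j + \sum_(i in S :\ j) w i)))%N _.
  by rewrite -sumS -card_S cardS.
by rewrite mulnCA leq_mul2l mulnDr mulSn leq_add2r lightj orbT.
Qed.

(** Edges are unordered, so the color is chosen from the set alone: it has to satisfy [P] for both
    orders of the ends, which the symmetry of [P] permits. *)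
Lemma exists_edge_coloring n t (P : 'I_n -> 'I_n -> 'I_t -> bool) :
  (0 < t)%N -> (forall x y i, P x y i = P y x i) ->
  (forall x y, x != y -> exists i, P x y i) ->
  exists c : edge_coloring n t, forall x y, x != y -> P x y (c [set x; y]).
Proof.
move=> t_gt0 symP exP.
pose good (S : {set 'I_n}) i :=
  [forall x in S, forall y in S, (x != y) ==> P x y i].
(* The default color is taken only on sets without a good color, never on an edge. *)
exists [ffun S => odflt (Ordinal t_gt0) [pick i | good S i]] => x y nxy.
rewrite ffunE; case: pickP => [i /forall_inP goodi | none] /=.
  by have /forall_inP/(_ y (set22 x y))/implyP-> := goodi x (set21 x y).
have [i Pi] := exP x y nxy; case/negP: (none i).
apply/forall_inP => u /set2P[]->; apply/forall_inP => v /set2P[]->;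
  by rewrite ?eqxx ?Pi ?implybT // symP Pi implybT.
Qed.

Lemma nonbipartite_edge (H : sgraph) :
  ~ bipartite H -> exists u v : H, adj u v.
Proof.
move=> Hnonbip.
have [/existsP[u /existsP[v uv]] | none] := boolP [exists u, [exists v : H, adj u v]].
  by exists u, v.
case: Hnonbip; exists xpredT => u v uv; case/negP: none.
by apply/existsP; exists u; apply/existsP; exists v.
Qed.

(** * Monochromatic copies and disjoint families *)

Section Copies.
Variables (H : sgraph) (n t : nat) (c : edge_coloring n t).
Implicit Types (f g : {ffun H -> 'I_n}) (F G : {set {ffun H -> 'I_n}}).

Lemma copy_of_colorP i f :
  reflect (injective f /\ forall u v, adj u v -> c [set f u; f v] = i)
    (copy_of_color c i f).
Proof.
apply: (iffP andP) => [[/injectiveP injf /forallP colf] | [injf colf]].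
  by split=> // u v uv; apply/eqP; have /forallP/(_ v)/implyP-> := colf u.
split; first exact/injectiveP.
by apply/forallP => u; apply/forallP => v; apply/implyP => /colf->.
Qed.

(** Non-bipartiteness yields an edge of [H], and its image has a single color. *)
Lemma copy_of_color_inj f i j : ~ bipartite H ->
  copy_of_color c i f -> copy_of_color c j f -> i = j.
Proof.
move=> /nonbipartite_edge[u [v uv]].
by move=> /copy_of_colorP[_ /(_ u v uv)<-] /copy_of_colorP[_ /(_ u v uv)].
Qed.

Lemma mono_copy_inj f : mono_copy c f -> injective f.
Proof. by case/existsP=> i /copy_of_colorP[]. Qed.

Lemma mono_disjoint_family_sub F G :
  G \subset F -> mono_disjoint_family c F -> mono_disjoint_family c G.
Proof.
move=> /subsetP sGF [monoF disjF]; split=> [f /sGF/monoF // | f g /sGF fF /sGF gF].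
exact: disjF.
Qed.

Lemma card_covered F : mono_disjoint_family c F ->
  #|covered F| = (#|F| * #|H|)%N.
Proof.
move=> [monoF disjF]; rewrite -sum_nat_const.
(* The union is extended to all maps, with empty sets outside [F], so that any two distinct indices
   give disjoint sets. *)
rewrite -sum1_card /covered [\bigcup_(f in F) _]big_mkcond.
rewrite partition_disjoint_bigcup => [|f g nfg] /=.
  rewrite [RHS]big_mkcond; apply: eq_bigr => f _; rewrite sum1_card.
  case: ifP => [/monoF/mono_copy_inj injf|_]; last by rewrite cards0.
  by rewrite card_imset ?cardsT.
by case: ifP => fF; case: ifP => gF; rewrite -?setI_eq0 ?set0I ?setI0 ?setI_eq0 ?disjF.
Qed.

End Copies.

(** * Packing copies in an arbitrary coloring *)

Section Packing.
Variables (H : sgraph) (n t : nat) (c : edge_coloring n t).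
Implicit Types (f g : {ffun H -> 'I_n}) (F G : {set {ffun H -> 'I_n}}).

(** The coloring is pulled back along an injection of ['I_m] into [A], where [m] is the Ramsey
    number; the copy found in [K_m] is then pushed forward. *)
Lemma ramsey_mono_copy_in (A : {set 'I_n}) : (ramsey t H <= #|A|)%N ->
  exists2 f : {ffun H -> 'I_n}, mono_copy c f & copy_verts f \subset A.
Proof.
rewrite /ramsey; case: ex_minnP => m Hm _ lemA.
pose g (x : 'I_m) := enum_val (widen_ord lemA x).
have injg : injective g by move=> x y /enum_val_inj[/ord_inj].
have /existsP[f /existsP[i /copy_of_colorP[injf colf]]] :=
  forallP Hm [ffun S : {set 'I_m} => c (g @: S)].
exists [ffun v => g (f v)].
  apply/existsP; exists i; apply/copy_of_colorP; split=> [u v | u v /colf].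
    by rewrite !ffunE => /injg/injf.
  by rewrite !ffunE imsetU1 imset_set1.
by apply/subsetP => _ /imsetP[v _ ->]; rewrite ffunE enum_valP.
Qed.

Lemma exists_large_family : (0 < #|H|)%N ->
  exists2 F : {set {ffun H -> 'I_n}}, mono_disjoint_family c F & (n <= #|covered F| + ramsey t H)%N.
Proof.
move=> /card_gt0P[v0 _].
pose famb (F : {set {ffun H -> 'I_n}}) := [forall f in F, mono_copy c f] &&
  [forall f in F, forall g in F, (f != g) ==> [disjoint copy_verts f & copy_verts g]].
have famP F : reflect (mono_disjoint_family c F) (famb F).
  apply: (iffP andP) => [[/forall_inP monoF /forall_inP disjF] | [monoF disjF]].
    by split=> // f g /disjF/forall_inP fF /fF/implyP.
  split; first exact/forall_inP.
  by apply/forall_inP => f ?; apply/forall_inP => g ?; apply/implyP; apply: disjF.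
have fam0 : famb set0 by apply/famP; split=> [f | f g]; rewrite inE.
case: (arg_maxnP (fun F => #|F|) fam0) => F /famP[monoF disjF] maxF.
exists F; first by [].
rewrite leqNgt; apply/negP => small.
have [|f monof] := @ramsey_mono_copy_in (~: covered F).
  by have := cardsC (covered F); rewrite card_ord; lia.
rewrite -disjoints_subset => disjf.
have disjfF g : g \in F -> [disjoint copy_verts f & copy_verts g].
  by move=> gF; apply: disjointWr disjf; apply: bigcup_sup.
(* Otherwise [f] would be disjoint from itself, yet it covers [f v0]. *)
have fF : f \notin F.
  apply/negP => /disjfF; rewrite -setI_eq0 setIid => /eqP/setP/(_ (f v0)).
  by rewrite imset_f ?inE.
have /maxF : famb (f |: F).
  apply/famP; split=> [g /setU1P[->|/monoF] // | g h].
  move=> /setU1P[->|gF] /setU1P[->|hF] ngh; rewrite ?eqxx // in ngh *.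
  - exact: disjfF.
  - by rewrite disjoint_sym disjfF.
  - exact: disjF.
by rewrite /= cardsU1 fF add1n ltnn.
Qed.

(** Each color is weighted by its number of copies, and the copies with color in a heavy set of [s]
    colors are kept. All copies have [#|H|] vertices, so counting copies amounts to counting covered
    vertices. *)
Lemma exists_few_colors_subfamily F s : (s <= t)%N -> ~ bipartite H ->
  mono_disjoint_family c F ->
  exists G : {set {ffun H -> 'I_n}}, [/\ mono_disjoint_family c G, (#|family_colors c G| <= s)%N
              & (s * #|covered F| <= t * #|covered G|)%N].
Proof.
move=> le_st Hnonbip famF.
have [->|/set0Pn[f0 f0F]] := eqVneq F set0.
  exists set0; split; rewrite /covered ?big_set0 ?cards0 ?muln0 //.
    by split=> [f | f g]; rewrite inE.
  rewrite (_ : family_colors _ _ = set0) ?cards0 //.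
  by apply/setP=> i; rewrite !inE; apply/existsP => -[f]; rewrite inE.
have /existsP[i0 _] := famF.1 _ f0F.
(* The default [i0] exists because [F] is nonempty here; members of [F] never fall back on it. *)
pose color (f : {ffun H -> 'I_n}) := odflt i0 [pick i | copy_of_color c i f].
have colorE f i : copy_of_color c i f -> color f = i.
  rewrite /color; case: pickP => [j cj ci|/(_ i)-> //].
  exact: copy_of_color_inj cj ci.
have := @exists_heavy_subset 'I_t (fun i => #|[set f in F | color f == i]|) s.
rewrite card_ord => /(_ le_st)[S cardS].
have countF (P : pred 'I_t) :
    (\sum_(i | P i) #|[set f in F | color f == i]|)%N = #|[set f in F | P (color f)]|.
  rewrite -[RHS]sum1_card (partition_big color P) => [|f]; last by rewrite inE => /andP[].
  apply: eq_bigr => i Pi; rewrite -sum1_card; apply: eq_bigl => f.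
  by rewrite !inE; case: eqP => [->|]; rewrite ?Pi ?andbF ?andbT.
rewrite !countF; set F' := [set f in F | _]; set G := [set f in F | _].
have -> : F' = F by apply/setP => f; rewrite inE andbT.
move=> heavyS.
have famG : mono_disjoint_family c G.
  apply: mono_disjoint_family_sub famF.
  by apply/subsetP => f; rewrite inE => /andP[].
exists G; split=> //; last first.
  have [-> ->] := (card_covered famF, card_covered famG).
  by rewrite !mulnA leq_mul2r heavyS orbT.
rewrite -cardS subset_leq_card //; apply/subsetP => i.
by rewrite inE => /existsP[f /andP[+ /colorE <-]]; rewrite inE => /andP[].
Qed.

End Packing.

(** * The extremal coloring *)

(* [V_i] is the residue class of [i] mod [t]; an edge between two classes [a]
   and [b] gets color [a - 1], or [b - 1] when [b = a - 1]. *)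
Lemma exists_class_coloring n t : (3 <= t)%N ->
  exists (part : 'I_n -> 'I_t) (side : 'I_t -> 'I_n -> bool) (c : edge_coloring n t),
    (forall x, part x = (x %% t)%N :> nat) /\
    (forall x y, x != y -> let i := c [set x; y] in
       (part x == i) && (part y == i) ||
       [&& part x != i, part y != i & side i x != side i y]).
Proof.
case: t => [|[|[|t]]] // _.
pose part (x : 'I_n) : 'I_t.+3 := inZp x.
pose side (i : 'I_t.+3) x := part x == i + 1.
exists part, side.
pose P x y i := (part x == i) && (part y == i) ||
  [&& part x != i, part y != i & side i x != side i y].
suff [c cP] : exists c : edge_coloring n t.+3,
  forall x y, x != y -> P x y (c [set x; y]) by exists c.
apply: exists_edge_coloring => // [x y i | x y _]; rewrite /P.
  by rewrite andbC andbCA [side i x == _]eq_sym.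
have sub1 (a : 'I_t.+3) : a != a - 1.
  by rewrite -subr_eq0 opprB addrC subrK.
have [<-|nab] := eqVneq (part x) (part y); first by exists (part x); rewrite eqxx.
rewrite /side; have [eba|nba] := eqVneq (part y) (part x - 1).
  exists (part y - 1); rewrite subrK eqxx sub1 (negPf nab) /=.
  (* Here [part y - 1] is [part x - 2], distinct from [part x] since there are at least three
     classes. *)
  suff -> : part x != part y - 1 by rewrite orbT.
  apply/negP => /eqP; rewrite eba -addrA -opprD => /eqP.
  by rewrite -subr_eq0 opprB addrCA subrr addr0 => /eqP/(congr1 val).
exists (part x - 1); rewrite subrK eqxx sub1 nba /=.
by rewrite [part y == part x]eq_sym (negPf nab) orbT.
Qed.

(** The quotient by [t] is injective on a residue class, with values below [n %/ t]. *)
Lemma card_residue_class n t i : (0 < t)%N -> (t %| n)%N ->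
  (#|[set x : 'I_n | x %% t == i]| <= n %/ t)%N.
Proof.
move=> t_gt0 t_n.
have ltq (x : 'I_n) : (x %/ t < n %/ t)%N by rewrite ltn_divLR // divnK.
rewrite -[X in (_ <= X)%N]card_ord.
rewrite -(@card_in_imset _ _ (fun x => Ordinal (ltq x))) ?max_card //.
move=> x y; rewrite !inE => /eqP xi /eqP yi [exy]; apply: val_inj => /=.
by rewrite (divn_eq x t) (divn_eq y t) exy xi yi.
Qed.

(** An edge of color [i] has both ends in [V_i] or neither, so by connectedness a copy of color [i]
    lies inside [V_i] or avoids it. In the latter case [side i] would give a bipartition of [H]. *)
Lemma exists_confining_coloring n t (H : sgraph) :
  (3 <= t)%N -> connected H -> ~ bipartite H ->
  exists c : edge_coloring n t, forall i (f : {ffun H -> 'I_n}),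
    copy_of_color c i f -> copy_verts f \subset [set x : 'I_n | x %% t == i]%N.
Proof.
move=> t_ge3 [_ Hconn] Hnonbip.
have [part [side [c [partE cP]]]] := exists_class_coloring n t_ge3.
exists c => i f /copy_of_colorP[injf colf].
have edgeP u v : adj u v -> (part (f u) == i) && (part (f v) == i) ||
    [&& part (f u) != i, part (f v) != i & side i (f u) != side i (f v)].
  move=> uv; rewrite -(colf u v uv); apply: cP.
  by apply: contraTneq uv => /injf->; rewrite adj_irrefl.
have partC u v : part (f u) == i -> part (f v) == i.
  have clo : closed (@adj H) [pred w | part (f w) == i].
    by move=> w w' /edgeP; rewrite !inE; case: (part (f w) == i); case: (part (f w') == i).
  by have := closed_connect clo (Hconn u v); rewrite !inE => ->.
have [/existsP[u ui] | none] := boolP [exists u, part (f u) == i].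
  by apply/subsetP => _ /imsetP[v _ ->]; rewrite inE -partE; apply: partC ui.
case: Hnonbip; exists (fun u => side i (f u)) => u v /edgeP.
have /existsPn/(_ u)/negPf-> := none.
by case/and3P.
Qed.

Theorem theorem11 (t s : nat) (ht : (3 <= t)%N) (hs1 : (1 <= s)%N)
    (hst : (s <= t)%N) (H : sgraph) (Hconn : connected H)
    (Hnonbip : ~ bipartite H) :
  (forall (n : nat) (c : edge_coloring n t),
     exists F : {set {ffun H -> 'I_n}},
       [/\ mono_disjoint_family c F,
           (#|family_colors c F| <= s)%N
         & (s%:R * (n%:R - (ramsey t H)%:R) / t%:R <= #|covered F|%:R :> rat)])
  /\
  (forall n : nat, (t %| n)%N ->
     exists c : edge_coloring n t,
       forall F : {set {ffun H -> 'I_n}},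
         mono_disjoint_family c F ->
         (#|family_colors c F| <= s)%N ->
         #|covered F|%:R <= s%:R * n%:R / t%:R :> rat).
Proof.
have t_gt0 : (0 < t)%N by apply: leq_trans ht.
split=> [n c | n t_n].
  have [F famF largeF] := exists_large_family c Hconn.1.
  have [G [famG colG heavyG]] := exists_few_colors_subfamily hst Hnonbip famF.
  exists G; split=> //.
  (* What remains in the naturals is [s * n <= #|covered G| * t + s * ramsey t H]. *)
  rewrite ler_pdivrMr ?ltr0n // mulrBr lerBlDr -!natrM -natrD ler_nat.
  by nia.
have [c cP] := exists_confining_coloring n ht Hconn Hnonbip.
exists c => F [monoF _] colF.
rewrite ler_pdivlMr ?ltr0n // -!natrM ler_nat.
have sub : covered F \subset
    \bigcup_(i in family_colors c F) [set x : 'I_n | x %% t == i]%N.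
  apply/bigcupsP => f fF; have /existsP[i fi] := monoF f fF.
  apply: subset_trans (cP i f fi) _; apply: bigcup_sup.
  by rewrite inE; apply/existsP; exists f; rewrite fF.
(* As [t] divides [n], the factor [t] cancels and the bound to reach is that of [s] classes of
   [n %/ t] vertices each. *)
rewrite -[X in (_ <= s * X)%N](divnK t_n) mulnA leq_mul2r; apply/orP; right.
apply: leq_trans (subset_leq_card sub) _.
apply: leq_trans (leq_mul colF (leqnn _)).
rewrite -sum_nat_const.
apply: (@leq_trans (\sum_(i in family_colors c F) #|[set x : 'I_n | x %% t == i]|)%N);
  last by apply: leq_sum => i _; apply: card_residue_class.
apply: (big_ind2 (fun (A : {set 'I_n}) k => (#|A| <= k)%N)) => [|A a B b leA leB|//].
  by rewrite cards0.
exact: leq_trans (leq_card_setU A B) (leq_add leA leB).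
Qed.
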